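(* Let $1<p<\infty$ and let $\gamma_p\in\Pi(\mu_1,\dots,\mu_N)$ be such that $\operatorname{spt}\gamma_p$ is $c_p$-monotone. Then there exists a countable cover $\{U_m\}_{m\in\mathbb N}$ of the set $D_\emptyset\cap\operatorname{spt}\gamma_p$ with the following property: for every $m\in\mathbb N$ there exists $L_m>0$ such that $$|\overline x_p(\mathbf y)-\overline x_p(\tilde{\mathbf y})|\ge L_m|\mathbf y-\tilde{\mathbf y}|$$ for any $\mathbf y=(y_1,\dots,y_N),\ \tilde{\mathbf y}=(\tilde y_1,\dots,\tilde y_N)\in D_\emptyset\cap\operatorname{spt}\gamma_p\cap U_m$.
   Context: Fix weights $\lambda_1,\dots,\lambda_N>0$ with $\sum_i\lambda_i=1$ and Borel probability measures $\mu_1,\dots,\mu_N$ on $\mathbb R^d$ with finite $p$-th moments. $\Pi(\mu_1,\dots,\mu_N)$ is the set of Borel probability measures on $\mathbb R^{Nd}=(\mathbb R^d)^N$ with $i$-th marginal $\mu_i$ for every $i$. $\overline x_p(x_1,\dots,x_N)$ is the unique minimizer over $z\in\mathbb R^d$ of $\sum_{i=1}^N\lambda_i|x_i-z|^p$, and $c_p(x_1,\dots,x_N):=\min_{z\in\mathbb R^d}\sum_{i=1}^N\lambda_i|x_i-z|^p$. $D_\emptyset:=\{\mathbf x=(x_1,\dots,x_N)\in\mathbb R^{Nd}:\ \overline x_p(\mathbf x)\ne x_i\text{ for every }i\in\{1,\dots,N\}\}$. A set $\Gamma\subset\mathbb R^{Nd}$ is $c_p$-monotone if for all $(x_1^1,\dots,x_N^1),(x_1^2,\dots,x_N^2)\in\Gamma$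 and all permutations $\sigma_1,\dots,\sigma_N$ of $\{1,2\}$, $c_p(x^1_1,\dots,x^1_N)+c_p(x^2_1,\dots,x^2_N)\le c_p(x^{\sigma_1(1)}_1,\dots,x^{\sigma_N(1)}_N)+c_p(x^{\sigma_1(2)}_1,\dots,x^{\sigma_N(2)}_N)$. *)

(* Defs.v *)
From HB Require Import structures.
From mathcomp Require Import all_boot all_order all_algebra all_fingroup.
From mathcomp Require Import all_classical all_reals all_analysis.

Set Implicit Arguments.
Unset Strict Implicit.
Unset Printing Implicit Defensive.

Import Order.TTheory GRing.Theory Num.Theory.
Import numFieldNormedType.Exports.

Local Open Scope classical_set_scope.
Local Open Scope ring_scope.

Notation borel T := (g_sigma_algebraType (@open T)).

(* A point (x_1, ..., x_N) of (R^d)^N is the N x d matrix whose i-th row is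
   x_i.  The library norm on matrices is the sup norm, hence enorm for the
   Euclidean norm, both on R^d = 'rV_d and on R^(Nd) = 'M_(N, d). *)
Definition enorm (R : realType) (m n : nat) (A : 'M[R]_(m, n)) : R :=
  Num.sqrt (\sum_i \sum_j A i j ^+ 2).

Definition bary_cost (R : realType) (N d : nat) (p : R) (lambda : 'I_N -> R)
    (x : 'M[R]_(N, d)) (z : 'rV[R]_d) : R :=
  \sum_i lambda i * enorm (row i x - z) `^ p.

Definition cp (R : realType) (N d : nat) (p : R) (lambda : 'I_N -> R)
    (x : 'M[R]_(N, d)) : R :=
  inf (range (bary_cost p lambda x)).

(* The default value 0 is irrelevant: for 1 < p and positive weights of sum 1
   the minimizer exists and is unique. *)
Definition xbar (R : realType) (N d : nat) (p : R) (lambda : 'I_N -> R)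
    (x : 'M[R]_(N, d)) : 'rV[R]_d :=
  xget 0 [set z | forall w, bary_cost p lambda x z <= bary_cost p lambda x w].

Definition D_empty (R : realType) (N d : nat) (p : R) (lambda : 'I_N -> R) :
    set 'M[R]_(N, d) :=
  [set x | forall i, xbar p lambda x <> row i x].

Definition finite_moment (R : realType) (d : nat) (p : R)
    (mu : probability (borel 'rV[R]_d) R) : Prop :=
  (\int[mu]_x (enorm (x : 'rV[R]_d) `^ p)%:E < +oo)%E.

Definition couplings (R : realType) (N d : nat)
    (mu : 'I_N -> probability (borel 'rV[R]_d) R) :
    set (probability (borel 'M[R]_(N, d)) R) :=
  [set gamma | forall i (A : set (borel 'rV[R]_d)), measurable A ->
    pushforward gamma (@row R N d i : borel 'M[R]_(N, d) -> borel 'rV[R]_d) A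
    = mu i A].

Definition spt (R : realType) (N d : nat)
    (gamma : probability (borel 'M[R]_(N, d)) R) : set 'M[R]_(N, d) :=
  [set x | forall V : set 'M[R]_(N, d), open V -> V x -> (0 < gamma V)%E].

Definition cp_monotone (R : realType) (N d : nat) (p : R) (lambda : 'I_N -> R)
    (Gamma : set 'M[R]_(N, d)) : Prop :=
  forall x : 'I_2 -> 'M[R]_(N, d), (forall k, Gamma (x k)) ->
  forall sigma : 'I_N -> {perm 'I_2},
    \sum_k cp p lambda (x k)
    <= \sum_k cp p lambda (\matrix_(i, j) x (sigma i k) i j).

(* Main.v *)
(* The pieces [U_m] are the configurations whose points all lie at distance
   between 1/(m+1) and m+1 from their barycenter.  Let [x], [y] be two of them,
   with barycenters [z], [w]; put [u = x_i - z], [v = y_i - w], [e = v - u],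
   [k = w - z] and exchange the [i]-th points.  Monotonicity bounds the optimal
   costs from above by the costs of the exchanged configurations tested at
   [z + t e] and [w - t e].  By stationarity of the barycenters, with
   [g] the gradient of [|.|^p], this reads
     0 <= lambda_i (g(v) - g(u)).(k - 2 t e) + O(|k - t e|^2 + t^2 |e|^2).
   On the annulus [g] is strongly monotone and Lipschitz, so a small fixed [t]
   yields [|e| <= C |k|], hence [|x_i - y_i| <= (C + 1) |z - w|]. *)
Require Import Defs.
From mathcomp Require Import all_boot all_order all_algebra all_fingroup.
From mathcomp Require Import all_classical all_reals all_analysis.
From mathcomp Require Import ring lra.

Set Implicit Arguments.
Unset Strict Implicit.

Import Order.TTheory GRing.Theory Num.Theory.
Import numFieldNormedType.Exports.

Local Open Scope classical_set_scope.
Local Open Scope ring_scope.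

(** * Euclidean inner product and norm *)

Definition dot (R : realType) (d : nat) (u v : 'rV[R]_d) : R :=
  \sum_j u 0 j * v 0 j.

Lemma dotC (R : realType) (d : nat) (u v : 'rV[R]_d) : dot u v = dot v u.
Proof. by apply: eq_bigr => j _; rewrite mulrC. Qed.

Lemma dotDl (R : realType) (d : nat) (u v w : 'rV[R]_d) :
  dot (u + v) w = dot u w + dot v w.
Proof. by rewrite -big_split; apply: eq_bigr => j _; rewrite mxE mulrDl. Qed.

Lemma dotZl (R : realType) (d : nat) (a : R) (u w : 'rV[R]_d) :
  dot (a *: u) w = a * dot u w.
Proof. by rewrite mulr_sumr; apply: eq_bigr => j _; rewrite mxE mulrA. Qed.

Lemma dotNl (R : realType) (d : nat) (u w : 'rV[R]_d) :
  dot (- u) w = - dot u w.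
Proof. by rewrite -scaleN1r dotZl mulN1r. Qed.

Lemma dotDr (R : realType) (d : nat) (u v w : 'rV[R]_d) :
  dot w (u + v) = dot w u + dot w v.
Proof. by rewrite dotC dotDl 2!(dotC w). Qed.

Lemma dotZr (R : realType) (d : nat) (a : R) (u w : 'rV[R]_d) :
  dot w (a *: u) = a * dot w u.
Proof. by rewrite dotC dotZl (dotC w). Qed.

Lemma dotNr (R : realType) (d : nat) (u w : 'rV[R]_d) :
  dot w (- u) = - dot w u.
Proof. by rewrite dotC dotNl (dotC w). Qed.

Definition dotE := (dotDl, dotDr, dotNl, dotNr, dotZl, dotZr).

Lemma dot_suml (R : realType) (d : nat) (I : finType) (P : pred I)
    (F : I -> 'rV[R]_d) (w : 'rV[R]_d) :
  dot (\sum_(i | P i) F i) w = \sum_(i | P i) dot (F i) w.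
Proof.
rewrite /dot exchange_big; apply: eq_bigr => j _.
by rewrite summxE mulr_suml.
Qed.

Lemma enorm_ge0 (R : realType) (m n : nat) (A : 'M[R]_(m, n)) : 0 <= enorm A.
Proof. exact: sqrtr_ge0. Qed.

Lemma enorm_sqr_rows (R : realType) (m n : nat) (A : 'M[R]_(m, n)) :
  enorm A ^+ 2 = \sum_i dot (row i A) (row i A).
Proof.
rewrite sqr_sqrtr; last by apply: sumr_ge0 => i _; apply: sumr_ge0 => j _; exact: sqr_ge0.
by apply: eq_bigr => i _; apply: eq_bigr => j _; rewrite !mxE expr2.
Qed.

Lemma enorm_sqr (R : realType) (d : nat) (u : 'rV[R]_d) :
  enorm u ^+ 2 = dot u u.
Proof. by rewrite enorm_sqr_rows big_ord1 !(row_id 0 u). Qed.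

Lemma enorm_eq0 (R : realType) (d : nat) (u : 'rV[R]_d) :
  enorm u = 0 -> u = 0.
Proof.
move=> u0; have /eqP : dot u u = 0 by rewrite -enorm_sqr u0 expr0n.
rewrite psumr_eq0 => [/allP u2|j _]; last by rewrite -expr2 sqr_ge0.
apply/rowP => j; rewrite mxE; apply/eqP.
by have := u2 j (mem_index_enum j); rewrite -expr2 sqrf_eq0.
Qed.

Lemma enormZ (R : realType) (d : nat) (a : R) (u : 'rV[R]_d) :
  enorm (a *: u) = `|a| * enorm u.
Proof.
apply/eqP; rewrite -(@eqrXn2 _ 2%N) ?mulr_ge0 ?enorm_ge0//.
by rewrite exprMn real_normK ?num_real// !enorm_sqr !dotE mulrA.
Qed.

Lemma enormN (R : realType) (d : nat) (u : 'rV[R]_d) : enorm (- u) = enorm u.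
Proof. by rewrite -scaleN1r enormZ normrN1 mul1r. Qed.

(** Cauchy-Schwarz: for nonzero vectors, expand $||v| u - |u| v|^2 \ge 0$ and divide by $2 |u|
    |v|$. *)
Lemma dot_le (R : realType) (d : nat) (u v : 'rV[R]_d) :
  dot u v <= enorm u * enorm v.
Proof.
have [/enorm_eq0 ->|u0] := eqVneq (enorm u) 0.
  by rewrite -(scale0r (0 : 'rV[R]_d)) dotZl mul0r mulr_ge0 ?enorm_ge0.
have [/enorm_eq0 ->|v0] := eqVneq (enorm v) 0.
  by rewrite -(scale0r (0 : 'rV[R]_d)) dotZr mul0r mulr_ge0 ?enorm_ge0.
have /(mulr_gt0 _) : 0 < enorm u by rewrite lt_def u0 enorm_ge0.
move=> /(_ (enorm v)); rewrite lt_def v0 enorm_ge0 => /(_ isT) uv.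
have := sqr_ge0 (enorm (enorm v *: u - enorm u *: v)).
rewrite enorm_sqr !dotE -!enorm_sqr (dotC v) => h.
rewrite -subr_ge0 -(pmulr_rge0 _ uv); nra.
Qed.

Lemma dot_ge (R : realType) (d : nat) (u v : 'rV[R]_d) :
  - (enorm u * enorm v) <= dot u v.
Proof. by have := dot_le (- u) v; rewrite dotNl enormN lerNl. Qed.

Lemma enormD (R : realType) (d : nat) (u v : 'rV[R]_d) :
  enorm (u + v) <= enorm u + enorm v.
Proof.
rewrite -(@ler_pXn2r _ 2) ?nnegrE ?addr_ge0 ?enorm_ge0//.
rewrite enorm_sqr !dotE (dotC v) sqrrD !enorm_sqr; have := dot_le u v; lra.
Qed.

Lemma enormB (R : realType) (d : nat) (u v : 'rV[R]_d) :
  enorm (u - v) <= enorm u + enorm v.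
Proof. by rewrite (le_trans (enormD _ _))// enormN. Qed.

Lemma sum_sqr_le (R : realType) (I : finType) (F : I -> R) :
  (forall i, 0 <= F i) -> \sum_i F i ^+ 2 <= (\sum_i F i) ^+ 2.
Proof.
(* Nonnegativity of the partial sum is carried along the induction: it makes the cross term
   nonnegative. *)
move=> F0; have : 0 <= \sum_i F i /\ \sum_i F i ^+ 2 <= (\sum_i F i) ^+ 2.
  elim/big_rec2 : _ => [|i x y _ [x0 yx]]; first by rewrite expr0n.
  have := F0 i; split; nra.
by case.
Qed.

Lemma enormB_sqr_le (R : realType) (d : nat) (u v : 'rV[R]_d) :
  enorm (u - v) ^+ 2 <= 2 * enorm u ^+ 2 + 2 * enorm v ^+ 2.
Proof.
have := sqr_ge0 (enorm (u + v)); rewrite !enorm_sqr !dotE (dotC v u); lra.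
Qed.

Lemma enorm_le_sum (R : realType) (m n : nat) (A : 'M[R]_(m, n)) :
  enorm A <= \sum_i enorm (row i A).
Proof.
have S0 : 0 <= \sum_i enorm (row i A).
  by apply: sumr_ge0 => i _; exact: enorm_ge0.
rewrite -(@ler_pXn2r _ 2) ?nnegrE ?enorm_ge0// enorm_sqr_rows.
under eq_bigr do rewrite -enorm_sqr.
by apply: sum_sqr_le => i; exact: enorm_ge0.
Qed.

(** * Real powers on an interval bounded away from 0 *)

(** The power is monotone, increasing or decreasing with the sign of [q], so its endpoint values are
    bounds; on an empty interval any constants serve. *)
Lemma powR_bounded (R : realType) (a b q : R) : 0 < a ->
  exists m, exists M, [/\ 0 < m, 0 < M &
    forall t, a <= t <= b -> m <= t `^ q <= M].
Proof.
move=> a0; have pos t : a <= t -> t \is Num.nneg.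
  by move=> at_; rewrite nnegrE (le_trans (ltW a0)).
wlog ab : / a <= b => [hw|].
  have [/hw//|ba] := leP a b.
  by exists 1, 1; split=> // t /andP[h /(le_trans h)]; rewrite leNgt ba.
have b0 : 0 < b by exact: lt_le_trans ab.
have [q0|q0] := leP 0 q.
  exists (a `^ q), (b `^ q); split; rewrite ?powR_gt0// => t /andP[at_ tb].
  by rewrite !ge0_ler_powR// pos.
have inv t : 0 < t -> t `^ q = (t `^ (- q))^-1 by rewrite powRN invrK.
exists (b `^ q), (a `^ q); split; rewrite ?powR_gt0// => t /andP[at_ tb].
have t0 : 0 < t by exact: lt_le_trans at_.
have q0' : 0 <= - q by rewrite oppr_ge0 ltW.
by rewrite !inv// !lef_pV2 ?posrE ?powR_gt0// !ge0_ler_powR// pos.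
Qed.

(** The mean value theorem with [s] and [t] in either order. That [x] is no farther from [s] than
    [t] is serves the second-order bound. *)
Lemma powR_mvt (R : realType) (a b q s t : R) : 0 < a ->
  a <= s <= b -> a <= t <= b ->
  exists x, [/\ a <= x <= b, `|x - s| <= `|t - s| &
    t `^ q - s `^ q = q * x `^ (q - 1) * (t - s)].
Proof.
move=> a0.
have mvt u v : a <= u -> u <= v -> exists2 x, u <= x <= v &
    v `^ q - u `^ q = q * x `^ (q - 1) * (v - u).
  move=> au uv; have u0 : 0 < u by exact: lt_le_trans au.
  have D x : x \in `[u, v] -> is_derive x 1 (@powR R ^~ q) (q * x `^ (q - 1)).
    rewrite in_itv/= => /andP[ux _].
    by apply: is_derive1_powR; exact: lt_le_trans ux.
  have D' x : x \in `]u, v[ -> is_derive x 1 (@powR R ^~ q) (q * x `^ (q - 1)).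
    by move=> xuv; apply: D; exact: subset_itv_oo_cc xuv.
  have C : {within `[u, v], continuous (@powR R ^~ q)}.
    by apply: derivable_within_continuous => x xuv; have [] := D x xuv.
  have [c] := MVT_segment uv D' C.
  by rewrite in_itv/= => cuv E; exists c.
move=> /andP[as_ sb] /andP[at_ tb].
have [st|/ltW ts] := leP s t.
- have [x /andP[sx xt] E] := mvt s t as_ st.
  exists x; split=> //; first by apply/andP; split; lra.
  by rewrite !ger0_norm ?subr_ge0// lerD2r.
- have [x /andP[tx xs] E] := mvt t s at_ ts.
  exists x; split=> //; first by apply/andP; split; lra.
    by rewrite !ler0_norm ?subr_le0// !opprB lerD2l lerN2.
  by rewrite -opprB E -mulrN opprB.
Qed.

Lemma powR_lipschitz (R : realType) (a b q : R) : 0 < a ->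
  exists2 M, 0 < M & forall s t, a <= s <= b -> a <= t <= b ->
    `|t `^ q - s `^ q| <= M * `|t - s|.
Proof.
move=> a0; have [m [M [_ M0 bnd]]] := powR_bounded b (q - 1) a0.
(* The summand 1 keeps the constant positive when [q] is 0. *)
exists (`|q| * M + 1) => [|s t sab tab].
  by rewrite ltr_wpDl// mulr_ge0// ltW.
have [x [/bnd/andP[_ xM] _ ->]] := powR_mvt q a0 sab tab.
rewrite normrM ler_wpM2r// normrM (ger0_norm (powR_ge0 _ _)).
by rewrite (le_trans (ler_wpM2l _ xM))// lerDl.
Qed.

(** The increment is $q x^{q-1} (t - s)$ for an intermediate $x$; replacing $x^{q-1}$ by $s^{q-1}$
    costs at most a multiple of $|x - s| \le |t - s|$. *)
Lemma powR_le_quadratic (R : realType) (a b q : R) : 0 < a ->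
  exists2 M, 0 < M & forall s t, a <= s <= b -> a <= t <= b ->
    t `^ q <= s `^ q + q * s `^ (q - 1) * (t - s) + M * (t - s) ^+ 2.
Proof.
move=> a0; have [M M0 lip] := powR_lipschitz b (q - 1) a0.
exists (`|q| * M + 1) => [|s t sab tab].
  by rewrite ltr_wpDl// mulr_ge0// ltW.
have [x [xab xs E]] := powR_mvt q a0 sab tab.
rewrite -addrA -lerBlDl E -lerBlDl -mulrBl -mulrBr.
rewrite (le_trans (ler_norm _))// !normrM -[in leRHS]real_normK ?num_real//.
rewrite expr2 mulrA ler_wpM2r//.
rewrite mulrDl mul1r (le_trans (ler_wpM2l (normr_ge0 q) (lip _ _ sab xab)))//.
by rewrite -[leLHS]addr0 lerD// -mulrA ler_wpM2l// ler_wpM2l// ltW.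
Qed.

Lemma powR_strongly_monotone (R : realType) (a b q : R) : 0 < a -> 0 < q ->
  exists2 c, 0 < c & forall s t, a <= s <= b -> a <= t <= b ->
    c * (t - s) ^+ 2 <= (t `^ q - s `^ q) * (t - s).
Proof.
move=> a0 q0; have [m [M [m0 _ bnd]]] := powR_bounded b (q - 1) a0.
exists (q * m) => [|s t sab tab]; first exact: mulr_gt0.
have [x [/bnd/andP[mx _] _ ->]] := powR_mvt q a0 sab tab.
by rewrite -mulrA -expr2 ler_wpM2r ?sqr_ge0// ler_pM2l.
Qed.

(** * The gradient of $|.|^p$ on an annulus *)

Lemma enorm_dist (R : realType) (d : nat) (u v : 'rV[R]_d) :
  `|enorm v - enorm u| <= enorm (v - u).
Proof.
rewrite ler_distl; apply/andP; split.
  by have := enormB v (v - u); rewrite subKr; lra.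
by have := enormD u (v - u); rewrite subrKC; lra.
Qed.

(** The gradient of $|.|^p$ away from the origin. *)
Definition pgrad (R : realType) (d : nat) (p : R) (v : 'rV[R]_d) : 'rV[R]_d :=
  (p * enorm v `^ (p - 2)) *: v.

Lemma powR_sqr (R : realType) (t q : R) : 0 <= t -> (t ^+ 2) `^ (q / 2) = t `^ q.
Proof. by move=> t0; rewrite -powR_mulrn// -powRrM mulrCA mulfV// mulr1. Qed.

(* [|v|^p] is a power of [|v|^2], which is polynomial, so a second-order bound
   for powers of positive reals suffices. *)
Lemma enorm_powR_le_quadratic (R : realType) (d : nat) (p r s : R) : 0 < r ->
  exists2 M, 0 < M & forall v b : 'rV[R]_d, r <= enorm v <= s ->
    enorm b <= r / 2 ->
    enorm (v + b) `^ p <= enorm v `^ p + dot (pgrad p v) b + M * enorm b ^+ 2.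
Proof.
move=> r0; have r2 : 0 < (r / 2) ^+ 2 by rewrite exprn_gt0// divr_gt0.
(* Since $|b| \le r/2 \le s/2$, both $|v|$ and $|v + b|$ lie between $r/2$ and $2s$. *)
have [M M0 quad] := powR_le_quadratic ((2 * s) ^+ 2) (p / 2) r2.
have [? [W [_ W0 bnd]]] := powR_bounded s (p - 2) r0.
exists (`|p| * W + 9 * s ^+ 2 * M + 1) => [|v b vrs bs].
  have := mulr_ge0 (normr_ge0 p) (ltW W0).
  have := mulr_ge0 (sqr_ge0 s) (ltW M0); lra.
have b0 := enorm_ge0 b; have vb0 := enorm_ge0 (v + b).
have [rv vs] := andP vrs.
have vb1 : enorm (v + b) <= enorm v + enorm b by exact: enormD.
have vb2 : enorm v <= enorm (v + b) + enorm b.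
  by have := enormB (v + b) b; rewrite addrK.
have := quad (enorm v ^+ 2) (enorm (v + b) ^+ 2).
rewrite !powR_sqr ?enorm_ge0//.
rewrite (_ : p / 2 - 1 = (p - 2) / 2); last by field.
rewrite powR_sqr ?enorm_ge0//.
rewrite (_ : enorm (v + b) ^+ 2 - enorm v ^+ 2 = 2 * dot v b + enorm b ^+ 2); last first.
  by rewrite !enorm_sqr !dotE (dotC b); ring.
have sq (x y : R) : 0 <= x -> x <= y -> x ^+ 2 <= y ^+ 2 by move=> *; nra.
move=> {}quad; apply: (le_trans (quad _ _)).
- by clear -r0 b0 vb0 rv vs vb1 vb2 bs sq; apply/andP; split; apply: sq; lra.
- by clear -r0 b0 vb0 rv vs vb1 vb2 bs sq; apply/andP; split; apply: sq; lra.
rewrite /pgrad dotZl -!addrA lerD2l.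
(* [X] is the increment of $|.|^2$. From $|X| \le 3 s |b|$ its square contributes $9 s^2 M |b|^2$;
   its linear part gives the gradient term plus a multiple of $|b|^2$ controlled by [W]. *)
set X := 2 * dot v b + _.
have X3 : X ^+ 2 <= 9 * s ^+ 2 * enorm b ^+ 2.
  have : X <= 3 * s * enorm b /\ - (3 * s * enorm b) <= X.
    rewrite /X; move: (dot_le v b) (dot_ge v b).
    by clear -r0 b0 rv vs bs; split; nra.
  by case; clear; nra.
have {}X3 := ler_wpM2l (ltW M0) X3.
have pw : p * enorm v `^ (p - 2) <= `|p| * W.
  rewrite (le_trans (ler_norm _))// normrM ler_wpM2l// ger0_norm ?powR_ge0//.
  by have /andP[] := bnd _ vrs.
have pW : 0 <= `|p| * W by rewrite mulr_ge0// ltW.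
have := ler_wpM2r (sqr_ge0 (enorm b)) pw.
have := sqr_ge0 (enorm b).
have := mulr_ge0 pW (sqr_ge0 (enorm b)).
move: X3; have -> : p / 2 * enorm v `^ (p - 2) * X = p * enorm v `^ (p - 2) * dot v b
    + p * enorm v `^ (p - 2) * enorm b ^+ 2 / 2 by rewrite /X; field.
by clear; lra.
Qed.

Lemma pgrad_lipschitz (R : realType) (d : nat) (p r s : R) : 0 < r ->
  exists2 M, 0 < M & forall u v : 'rV[R]_d, r <= enorm u <= s ->
    r <= enorm v <= s -> enorm (pgrad p v - pgrad p u) <= M * enorm (v - u).
Proof.
move=> r0; have [M M0 lip] := powR_lipschitz s (p - 2) r0.
have [? [W [_ W0 bnd]]] := powR_bounded s (p - 2) r0.
exists (`|p| * (W + M * `|s|) + 1) => [|u v us vs].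
  by rewrite ltr_wpDl// mulr_ge0// addr_ge0 ?mulr_ge0// ltW.
(* Change the vector first and the scalar factor second: each piece is a multiple of $|v - u|$, the
   second by the Lipschitz bound for $t^{p-2}$. *)
have -> : pgrad p v - pgrad p u = (p * enorm v `^ (p - 2)) *: (v - u)
    + (p * (enorm v `^ (p - 2) - enorm u `^ (p - 2))) *: u.
  by rewrite scalerBr mulrBr scalerBl addrA subrK.
rewrite (le_trans (enormD _ _))// !enormZ !normrM (ger0_norm (powR_ge0 _ _)).
have /andP[_ vW] := bnd _ vs.
have := ler_wpM2l (normr_ge0 p) (ler_wpM2r (enorm_ge0 (v - u)) vW).
have uS : enorm u <= `|s|.
  by have /andP[_ h] := us; rewrite (le_trans h)// ler_norm.
have lip1 : `|enorm v `^ (p - 2) - enorm u `^ (p - 2)| <= M * enorm (v - u).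
  by rewrite (le_trans (lip _ _ us vs))// ler_wpM2l ?enorm_dist// ltW.
have := ler_wpM2l (normr_ge0 p) (ler_pM (normr_ge0 _) (enorm_ge0 _) lip1 uS).
have := enorm_ge0 (v - u); lra.
Qed.

(** The inner product splits into a radial part, controlled by strong monotonicity of $t^{p-1}$
    (here $1 < p$ enters), and an angular part $|u| |v| - u.v \ge 0$ whose coefficient is controlled
    by the lower bound on $t^{p-2}$. *)
Lemma pgrad_strongly_monotone (R : realType) (d : nat) (p r s : R) :
  0 < r -> 1 < p ->
  exists2 c, 0 < c & forall u v : 'rV[R]_d, r <= enorm u <= s ->
    r <= enorm v <= s ->
    c * enorm (v - u) ^+ 2 <= dot (pgrad p v - pgrad p u) (v - u).
Proof.
move=> r0 p1; have p0 : 0 < p by exact: lt_trans p1.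
have p10 : 0 < p - 1 by rewrite subr_gt0.
have [c0 c00 mono] := powR_strongly_monotone s r0 p10.
have [c1 [? [c10 _ bnd]]] := powR_bounded s (p - 2) r0.
exists (p * Num.min c0 c1) => [|u v us vs].
  by rewrite mulr_gt0// lt_min c00.
have /andP[+ _] := bnd _ us; have /andP[+ _] := bnd _ vs.
have := mono _ _ us vs.
have E t : r <= t <= s -> t `^ (p - 1) = t * t `^ (p - 2).
  move=> /andP[rt _]; rewrite -(@mulr_powRB1 _ t (p - 1)) ?(le_trans (ltW r0))//.
  by congr (_ * _ `^ _); ring.
rewrite !E// enorm_sqr /pgrad !dotE -!enorm_sqr !(dotC v u).
have := dot_le u v.
have : Num.min c0 c1 <= c0 by rewrite ge_min lexx.
have : Num.min c0 c1 <= c1 by rewrite ge_min lexx orbT.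
move: (Num.min _ _) (dot u v) (enorm u) (enorm v) (_ `^ _) (_ `^ _).
move=> c x a b A B cc1 cc0 xab h hB hA.
rewrite -subr_ge0.
(* Here [a], [b] are the norms, [A], [B] their powers of exponent $p - 2$, and [x] is the inner
   product; both summands are nonnegative, as [c] is at most [A] and [B]. *)
rewrite (_ : _ - _ = p * (((b * B - a * A) * (b - a) - c * (b - a) ^+ 2)
  + (a * b - x) * (A + B - 2 * c))); last by ring.
apply: mulr_ge0; first exact: ltW.
have := ler_wpM2r (sqr_ge0 (b - a)) cc0; nra.
Qed.

(** * Existence of the barycenter and bounds on the optimal cost *)

Lemma coord_le_enorm (R : realType) (d : nat) (v : 'rV[R]_d) (j : 'I_d) :
  `|v 0 j| <= enorm v.
Proof.
rewrite -(@ler_pXn2r _ 2) ?nnegrE ?enorm_ge0// enorm_sqr real_normK ?num_real//.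
rewrite /dot (bigD1 j)//= -expr2 lerDl; apply: sumr_ge0 => k _.
by rewrite -expr2 sqr_ge0.
Qed.

Lemma enorm_continuous (R : realType) (d : nat) :
  continuous (fun v : 'rV[R]_d => enorm v).
Proof.
have sq : continuous (fun v : 'rV[R]_d => \sum_i \sum_j v i j ^+ 2).
  apply: continuous_big => [|i _]; first exact: add_continuous.
  apply: continuous_big => [|j _]; first exact: add_continuous.
  move=> v; apply: (@continuous_comp _ _ _ (fun v : 'rV[R]_d => v i j)
    (fun t : R => t ^+ 2)); first exact: coord_continuous.
  exact: exprn_continuous.
move=> v; apply: (@continuous_comp _ _ _ _ (@Num.sqrt R)); first exact: sq.
exact: sqrt_continuous.
Qed.

(* The absolute value matters: the library sets [t `^ p = 1] for [t < 0]. *)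
Lemma norm_powR_continuous (R : realType) (p : R) : 1 <= p ->
  continuous (fun t : R => `|t| `^ p).
Proof.
move=> p1 t; have [->|t0] := eqVneq t 0; last first.
  apply: (@continuous_comp _ _ _ (@Num.norm _ R) (fun t : R => t `^ p)).
    exact: norm_continuous.
  apply/differentiable_continuous/derivable1_diffP.
  by apply: derivable_powR; rewrite in_itv/= normr_gt0 t0.
rewrite /continuous_at normr0 powR0 ?gt_eqF ?(lt_le_trans _ p1)//.
apply/cvgrPdist_le => e e0; near=> x.
have x1 : `|x| <= Num.min e 1.
  near: x; apply: (@nbhs0_le _ R).
  by rewrite lt_min e0 ltr01.
move: x1; rewrite le_min => /andP[xe x1].
rewrite sub0r normrN ger0_norm ?powR_ge0//.
have [->|x0] := eqVneq x 0.
  by rewrite normr0 powR0 ?(ltW e0)// gt_eqF// (lt_le_trans _ p1).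
by rewrite (le_trans _ xe)// ge1r_powR// normr_gt0 x0.
Unshelve. all: by end_near. Qed.

Lemma bary_cost_continuous (R : realType) (N d : nat) (p : R)
    (lambda : 'I_N -> R) (x : 'M[R]_(N, d)) : 1 <= p ->
  continuous (bary_cost p lambda x).
Proof.
move=> p1; apply: continuous_big => [|i _]; first exact: add_continuous.
move=> z.
have sub : {for z, continuous (fun z : 'rV[R]_d => row i x - z)}.
  by apply: continuousB; [exact: cst_continuous|exact: cvg_id].
have nrm := continuous_comp sub (@enorm_continuous R d _).
have pw : {for enorm (row i x - z), continuous (fun t : R => `|t| `^ p)}.
  exact: norm_powR_continuous.
have := @continuous_comp _ _ _ _ _ _ nrm pw.
rewrite (_ : _ \o _ = (fun z => enorm (row i x - z) `^ p)); last first.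
  by apply/funext => w /=; rewrite ger0_norm ?enorm_ge0.
by apply: continuousM; exact: cst_continuous.
Qed.

Lemma bary_cost_ge0 (R : realType) (N d : nat) (p : R) (lambda : 'I_N -> R)
    (lambda_ge0 : forall i, 0 <= lambda i) (x : 'M[R]_(N, d)) (z : 'rV[R]_d) :
  0 <= bary_cost p lambda x z.
Proof. by apply: sumr_ge0 => i _; rewrite mulr_ge0// powR_ge0. Qed.

Lemma bary_cost_ge_term (R : realType) (N d : nat) (p : R) (lambda : 'I_N -> R)
    (lambda_ge0 : forall i, 0 <= lambda i) (x : 'M[R]_(N, d)) (z : 'rV[R]_d)
    (i : 'I_N) :
  lambda i * enorm (row i x - z) `^ p <= bary_cost p lambda x z.
Proof.
rewrite /bary_cost (bigD1 i)//= lerDl; apply: sumr_ge0 => j _.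
by rewrite mulr_ge0// powR_ge0.
Qed.

(** Direct method: the term of index [i0] has positive weight and is coercive, so the sublevel set
    through 0 is compact and the continuous cost attains its minimum there. *)
Lemma bary_cost_minimizer (R : realType) (N d : nat) (p : R)
    (lambda : 'I_N -> R) (x : 'M[R]_(N, d)) (i0 : 'I_N) :
  (forall i, 0 <= lambda i) -> 0 < lambda i0 -> 1 <= p ->
  exists z, forall w, bary_cost p lambda x z <= bary_cost p lambda x w.
Proof.
move=> l0 li0 p1; pose f := bary_cost p lambda x.
pose K : set 'rV[R]_d := [set z | f z <= f 0].
(* On [K], either $|x_{i_0} - z| \le 1$, or this distance is at most its $p$-th power, hence at most
   $f(0) / \lambda_{i_0}$. *)
pose B := enorm (row i0 x) + (1 + f 0 / lambda i0).
have fl : 0 <= f 0 / lambda i0 by rewrite divr_ge0 ?bary_cost_ge0.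
have KB z : K z -> enorm z <= B.
  move=> Kz; have xz : enorm (row i0 x - z) <= 1 + f 0 / lambda i0.
    have [h|/ltW h] := leP (enorm (row i0 x - z)) 1.
      by apply: le_trans h _; rewrite lerDl.
    have lz : lambda i0 * enorm (row i0 x - z) <= f 0.
      apply: le_trans Kz; apply: le_trans (bary_cost_ge_term p l0 x z i0).
      by rewrite ler_pM2l// le1r_powR.
    by rewrite ler_wpDl// ler_pdivlMr// mulrC.
  rewrite /B -[z](subKr (row i0 x)); apply: le_trans (enormB _ _) _.
  by rewrite lerD2l.
have Kc : compact K.
  apply: (@subclosed_compact _ _
    [set v : 'rV[R]_d | forall j, v ord0 j \in `[- B, B]]).
  - apply: (@closed_comp _ _ f [set t | t <= f 0]); last exact: closed_le.
    by move=> z _; exact: bary_cost_continuous.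
  - apply: (@rV_compact R d (fun=> `[- B, B]%classic)) => _.
    exact: segment_compact.
  - move=> z /KB zB j; rewrite in_itv/= -ler_norml.
    exact: le_trans (coord_le_enorm z j) zB.
have [] := @compact_EVT_min _ R f K _ Kc.
- by exists 0; rewrite /K/=.
- by apply: continuous_subspaceT; exact: bary_cost_continuous.
move=> z _ zK; exists z => w.
case/orP: (le_total (f w) (f 0)) => wK; first exact: zK (mem_set wK).
exact: le_trans (zK 0 (mem_set (lexx (f 0)))) wK.
Qed.

(** As a minimizer exists, [xget] returns one and not its default value. *)
Lemma xbar_minimizes (R : realType) (N d : nat) (p : R)
    (lambda : 'I_N -> R) (x : 'M[R]_(N, d)) (i0 : 'I_N) (w : 'rV[R]_d) :
  (forall i, 0 <= lambda i) -> 0 < lambda i0 -> 1 <= p ->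
  bary_cost p lambda x (xbar p lambda x) <= bary_cost p lambda x w.
Proof.
move=> l0 li0 p1; have [z zP] := bary_cost_minimizer x l0 li0 p1.
pose P : set 'rV[R]_d :=
  [set z | forall w, bary_cost p lambda x z <= bary_cost p lambda x w].
exact: (@xgetI _ 0 P z zP w).
Qed.

Lemma cp_le (R : realType) (N d : nat) (p : R) (lambda : 'I_N -> R)
    (x : 'M[R]_(N, d)) (z : 'rV[R]_d) : (forall i, 0 <= lambda i) ->
  cp p lambda x <= bary_cost p lambda x z.
Proof.
(* The lower bound 0 makes [inf] a genuine infimum. *)
move=> l0; have lb : has_lbound (range (bary_cost p lambda x)).
  by exists 0 => _ [w _ <-]; exact: bary_cost_ge0.
by apply: (ge_inf lb); exists z.
Qed.

Lemma cp_ge (R : realType) (N d : nat) (p : R) (lambda : 'I_N -> R)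
    (x : 'M[R]_(N, d)) (t : R) : (forall z, t <= bary_cost p lambda x z) ->
  t <= cp p lambda x.
Proof.
move=> tx; apply: lb_le_inf => [|_ [w _ <-]//].
by exists (bary_cost p lambda x 0), 0.
Qed.

(** * Exchange of one point between two configurations *)

Definition exchange_row (R : realType) (N d : nat) (i : 'I_N)
    (x y : 'M[R]_(N, d)) : 'M[R]_(N, d) :=
  \matrix_(k, j) if k == i then y k j else x k j.

Lemma row_exchange (R : realType) (N d : nat) (i k : 'I_N)
    (x y : 'M[R]_(N, d)) :
  row k (exchange_row i x y) = if k == i then row k y else row k x.
Proof. by apply/rowP => j; rewrite !mxE; case: ifP; rewrite mxE. Qed.

(** Monotonicity with the transposition as $\sigma_i$ and the identity as every other
    permutation. *)
Lemma cp_monotone_exchange (R : realType) (N d : nat) (p : R)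
    (lambda : 'I_N -> R) (Gamma : set 'M[R]_(N, d)) (x y : 'M[R]_(N, d))
    (i : 'I_N) : cp_monotone p lambda Gamma -> Gamma x -> Gamma y ->
  cp p lambda x + cp p lambda y
    <= cp p lambda (exchange_row i x y) + cp p lambda (exchange_row i y x).
Proof.
rewrite /cp_monotone; move: (cp p lambda) => c mono Gx Gy.
pose X (k : 'I_2) := if k == 0 then x else y.
have GX k : Gamma (X k) by rewrite /X; case: ifP.
have two (F : 'I_2 -> R) : \sum_k F k = F 0 + F 1.
  by rewrite big_ord_recl big_ord1; congr (_ + F _); apply: val_inj.
pose sg k := if k == i then tperm 0 1 else 1%g : {perm 'I_2}.
have := mono X GX sg.
rewrite !two.
set A := \matrix_(k, j) X _ k j; set B := \matrix_(k, j) X _ k j.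
have -> : A = exchange_row i x y.
  by apply/matrixP => k j; rewrite !mxE /X /sg; case: (k == i);
    rewrite ?tpermL ?perm1.
have -> // : B = exchange_row i y x.
by apply/matrixP => k j; rewrite !mxE /X /sg; case: (k == i);
    rewrite ?tpermR ?perm1.
Qed.

(** * Second-order bound for the cost and stationarity of the barycenter *)

(** Weights of total at most 1 leave the constant [M] unchanged. The predicate [P] covers both the
    full sum, for stationarity, and the sum over the points that are not exchanged. *)
Lemma sum_enorm_powR_le_quadratic (R : realType) (N d : nat)
    (lambda : 'I_N -> R) (p r s M : R) :
  (forall i, 0 <= lambda i) -> \sum_i lambda i = 1 -> 0 <= M ->
  (forall v b : 'rV[R]_d, r <= enorm v <= s -> enorm b <= r / 2 ->
    enorm (v + b) `^ p <= enorm v `^ p + dot (pgrad p v) b + M * enorm b ^+ 2) ->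
  forall (P : pred 'I_N) (v : 'I_N -> 'rV[R]_d) (b : 'rV[R]_d),
    (forall i, r <= enorm (v i) <= s) -> enorm b <= r / 2 ->
    \sum_(i | P i) lambda i * enorm (v i + b) `^ p
      <= \sum_(i | P i) lambda i * enorm (v i) `^ p
        + dot (\sum_(i | P i) lambda i *: pgrad p (v i)) b + M * enorm b ^+ 2.
Proof.
move=> l0 l1 M0 quad P v b vrs br.
have lP : \sum_(i | P i) lambda i <= 1.
  by rewrite -l1 [leRHS](bigID P)/= lerDl; apply: sumr_ge0.
apply: (@le_trans _ _ (\sum_(i | P i) (lambda i * enorm (v i) `^ p
    + lambda i * dot (pgrad p (v i)) b + lambda i * (M * enorm b ^+ 2)))).
  apply: ler_sum => i _; rewrite -!mulrDr ler_wpM2l//; exact: quad.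
rewrite !big_split/= -mulr_suml dot_suml -!addrA lerD2l.
apply: lerD; last by rewrite ler_piMl// mulr_ge0 ?sqr_ge0.
by apply: ler_sum => i _; rewrite dotZl.
Qed.

(** Minimality is tested at $z + t G$: the upper bound gives $0 \le -t |G|^2 + M t^2 |G|^2$, which
    forces $G = 0$ for small $t > 0$. *)
Lemma bary_cost_stationary (R : realType) (N d : nat) (lambda : 'I_N -> R)
    (p r s : R) (x : 'M[R]_(N, d)) (z : 'rV[R]_d) :
  (forall i, 0 <= lambda i) -> \sum_i lambda i = 1 -> 0 < r ->
  (forall i, r <= enorm (row i x - z) <= s) ->
  (forall w, bary_cost p lambda x z <= bary_cost p lambda x w) ->
  \sum_i lambda i *: pgrad p (row i x - z) = 0.
Proof.
move=> l0 l1 r0 rs zmin; set G := \sum_i _.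
have [M M0 quad1] := @enorm_powR_le_quadratic R d p r s r0.
have quad := sum_enorm_powR_le_quadratic l0 l1 (ltW M0) quad1.
(* The first entry gives $M t \le 1/2$; the second keeps $t |G| \le r/2$, with a denominator that is
   positive even if $G = 0$. *)
pose t := Num.min (2 * M)^-1 (r / 2 / (enorm G + 1)).
have G0 := enorm_ge0 G.
have G1 : 0 < enorm G + 1 by rewrite ltr_wpDl.
have t0 : 0 < t by rewrite lt_min invr_gt0 mulr_gt0//= !divr_gt0.
have tM : t * (2 * M) <= 1.
  by rewrite -ler_pdivlMr ?mulr_gt0// div1r ge_min lexx.
have tG : t * (enorm G + 1) <= r / 2.
  by rewrite -ler_pdivlMr// ge_min lexx orbT.
have nb : enorm (- (t *: G)) = t * enorm G by rewrite enormN enormZ gtr0_norm.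
have br : enorm (- (t *: G)) <= r / 2.
  by rewrite nb (le_trans _ tG)// ler_pM2l// lerDl.
have := quad predT (fun i => row i x - z) (- (t *: G)) rs br.
have := zmin (z + t *: G); rewrite /bary_cost -/G.
under [X in _ <= X -> _]eq_bigr do rewrite opprD addrA.
move=> h1 h2; have {h1 h2} := le_trans h1 h2.
rewrite nb dotNr dotZr -enorm_sqr => h.
apply/enorm_eq0/eqP; rewrite -sqrf_eq0 eq_le sqr_ge0 andbT.
rewrite -(pmulr_rle0 _ t0).
have := ler_wpM2r (mulr_ge0 (ltW t0) (sqr_ge0 (enorm G))) tM.
move: h; move: (\sum_i _) (enorm G) => S g; clear; lra.
Qed.

(** * Displacement of a point bounded by displacement of the barycenter *)

Lemma bary_cost_exchange (R : realType) (N d : nat) (lambda : 'I_N -> R)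
    (p : R) (i : 'I_N) (x y : 'M[R]_(N, d)) (z : 'rV[R]_d) :
  bary_cost p lambda (exchange_row i x y) z
  = lambda i * enorm (row i y - z) `^ p
    + \sum_(j | j != i) lambda j * enorm (row j x - z) `^ p.
Proof.
have gen (G : 'rV[R]_d -> R) :
    \sum_j lambda j * G (row j (exchange_row i x y) - z)
    = lambda i * G (row i y - z) + \sum_(j | j != i) lambda j * G (row j x - z).
  rewrite (bigD1 i)//= row_exchange eqxx; congr (_ + _).
  by apply: eq_bigr => j /negPf ji; rewrite row_exchange ji.
exact: gen (fun v => enorm v `^ p).
Qed.

(** If $e > K k \ge k$, then $M k^2 \le M e k$, so division by $e$ gives $\kappa e \le (L + M) k \le
    \kappa K k$, a contradiction. *)
Lemma le_of_quadratic (R : realType) (kappa L M K e k : R) :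
  0 < kappa -> 0 <= L -> 0 <= M -> 1 <= K -> L + M <= kappa * K ->
  0 <= e -> 0 <= k -> kappa * e ^+ 2 <= L * e * k + M * k ^+ 2 -> e <= K * k.
Proof.
move=> kap0 L0 M0 K1 LM e0 k0 h; rewrite leNgt; apply/negP => Kke.
have kKk : k <= K * k by rewrite ler_peMl.
have ke : k <= e by exact: le_trans (ltW Kke).
have e1 : 0 < e by rewrite (le_lt_trans _ Kke)// mulr_ge0// (le_trans ler01).
have h1 : kappa * e <= (L + M) * k.
  rewrite -(ler_pM2r e1).
  have := ler_wpM2l (mulr_ge0 M0 k0) ke; clear -h; lra.
have h2 := ler_wpM2r k0 LM.
have : kappa * (K * k) < kappa * e by rewrite ltr_pM2l.
clear -h1 h2; lra.
Qed.

(** The arithmetic of the exchange. [u], [v] and [u'], [v'] stand for the $p$-th powers at the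
    exchanged point before and after, [Sx], [Sy], [Sx'], [Sy'] for the remaining sums, [m] for $|k -
    t e|^2$, and [gvk], [gva], [guk], [gua] for gradients paired with $k$ and $t e$. Adding up
    leaves a gain $2 t l c e^2$ against $L e k + 4 M k^2 + 6 M t^2 e^2$; the bound on $6 M t$
    absorbs the last term into half of the gain. *)
Lemma exchange_gain_le (R : realType)
    (l L M t c e k a m u v u' v' Sx Sy Sx' Sy' gvk gva guk gua : R) :
  0 <= l -> l <= 1 -> 0 <= L -> 0 <= M -> 0 <= t -> 0 <= e -> 0 <= k ->
  t * (6 * M) <= l * c -> a = t * e -> m <= 2 * k ^+ 2 + 2 * a ^+ 2 ->
  gvk - guk <= L * e * k -> t * (c * e ^+ 2) <= gva - gua ->
  l * v' <= l * (v + (gvk - gva) + M * m) ->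
  l * u' <= l * (u - (guk - gua) + M * m) ->
  Sx' <= Sx + l * gua + M * a ^+ 2 -> Sy' <= Sy - l * gva + M * a ^+ 2 ->
  l * u + Sx + (l * v + Sy) <= l * v' + Sx' + (l * u' + Sy') ->
  t * (l * c) * e ^+ 2 <= L * e * k + 4 * M * k ^+ 2.
Proof.
move=> l0 l1 L0 M0 t0 e0 k0 tM -> mka Dk Da qv qu qx qy h.
have h1 := ler_wpM2l l0 Dk.
have h2 : l * (L * e * k) <= L * e * k by rewrite ler_piMl// !mulr_ge0.
have h3 := ler_wpM2l l0 Da.
have h4 := ler_wpM2l M0 mka.
have m0 : l * (M * (2 * k ^+ 2 + 2 * (t * e) ^+ 2))
    <= M * (2 * k ^+ 2 + 2 * (t * e) ^+ 2).
  by rewrite ler_piMl// mulr_ge0// addr_ge0// mulr_ge0// sqr_ge0.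
have h5 := ler_wpM2l l0 h4.
have h6 := ler_wpM2r (mulr_ge0 t0 (sqr_ge0 e)) tM.
clear -h h1 h2 h3 h5 h6 m0 qv qu qx qy; lra.
Qed.

Lemma row_displacement_le (R : realType) (N d : nat) (lambda : 'I_N -> R)
    (p r s : R) (i : 'I_N) :
  (forall i, 0 < lambda i) -> \sum_i lambda i = 1 -> 1 < p -> 0 < r -> 0 < s ->
  exists2 K, 0 < K & forall (x y : 'M[R]_(N, d)) (z w : 'rV[R]_d),
    (forall k, r <= enorm (row k x - z) <= s) ->
    (forall k, r <= enorm (row k y - w) <= s) ->
    (forall v, bary_cost p lambda x z <= bary_cost p lambda x v) ->
    (forall v, bary_cost p lambda y w <= bary_cost p lambda y v) ->
    (forall a b, bary_cost p lambda x z + bary_cost p lambda y w <=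
      bary_cost p lambda (exchange_row i x y) a
      + bary_cost p lambda (exchange_row i y x) b) ->
    enorm (row i (x - y)) <= K * enorm (z - w).
Proof.
move=> l0 l1 p1 r0 s0; have l0' j : 0 <= lambda j by exact: ltW.
have [M M0 quad1] := @enorm_powR_le_quadratic R d p r s r0.
have quad := sum_enorm_powR_le_quadratic l0' l1 (ltW M0) quad1.
have [c c0 mono] := @pgrad_strongly_monotone R d p r s r0 p1.
have [L L0 lip] := @pgrad_lipschitz R d p r s r0.
pose l := lambda i; have li0 : 0 < l by exact: l0.
have li1 : l <= 1 by rewrite -l1 (bigD1 i)//= lerDl sumr_ge0.
(* The first entry lets the gain absorb the terms in $t^2 |e|^2$; the second gives $t |e| \le r/4$,
   because $|e| \le 2 s$. *)
pose t := Num.min (l * c / (6 * M)) (r / (8 * s)).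
have t0 : 0 < t by rewrite lt_min !divr_gt0 ?mulr_gt0.
have tM : t * (6 * M) <= l * c.
  by rewrite -ler_pdivlMr ?mulr_gt0// ge_min lexx.
have ts : t * (8 * s) <= r.
  by rewrite -ler_pdivlMr ?mulr_gt0// ge_min lexx orbT.
pose kappa := t * (l * c); have kappa0 : 0 < kappa by rewrite !mulr_gt0.
pose K0 := (L + 4 * M) / kappa + 1.
have q0 : 0 <= (L + 4 * M) / kappa.
  by rewrite divr_ge0 ?(ltW kappa0)// addr_ge0 ?mulr_ge0// ltW.
have K1 : 1 <= K0 by rewrite lerDr.
have Kk : L + 4 * M <= kappa * K0.
  by rewrite mulrDr mulr1 [kappa * _]mulrC divfK ?gt_eqF// lerDl ltW.
have K00 : 0 <= K0 by exact: le_trans K1.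
(* [K0] serves when the barycenters are close, [K2] when they are at least $r/4$ apart; the final 1
   pays for $k$ itself in $x_i - y_i = -(e + k)$. *)
pose K2 := 8 * s / r; have K20 : 0 < K2 by rewrite divr_gt0// mulr_gt0.
exists (K0 + K2 + 1) => [|x y z w xrs yrs zmin wmin exch].
  by rewrite ltr_wpDl// addr_ge0// ltW.
have Sx := bary_cost_stationary l0' l1 r0 xrs zmin.
have Sy := bary_cost_stationary l0' l1 r0 yrs wmin.
pose k := w - z; pose u := row i x - z; pose v := row i y - w.
pose e := v - u.
have urs : r <= enorm u <= s by exact: xrs.
have vrs : r <= enorm v <= s by exact: yrs.
have -> : enorm (z - w) = enorm k by rewrite -enormN opprB.
have -> : row i (x - y) = - (e + k).
  by apply/rowP => j; rewrite /e /k /u /v !mxE; ring.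
rewrite enormN (le_trans (enormD _ _))// mulrDl mul1r lerD2r mulrDl.
have k0 := enorm_ge0 k; have e0 := enorm_ge0 e.
have es : enorm e <= 2 * s.
  have /andP[_ us] := urs; have /andP[_ vs] := vrs.
  by rewrite (le_trans (enormB _ _))// mulr2n mulrDl mul1r lerD.
(* Far barycenters need no exchange: $|e| \le 2 s = K_2 r/4$. *)
have [kr|/ltW kr] := leP (r / 4) (enorm k).
  rewrite ler_wpDl ?mulr_ge0// (le_trans es)//.
  have -> : 2 * s = K2 * (r / 4) by rewrite /K2; field; rewrite gt_eqF.
  by rewrite ler_pM2l.
have M4 : 0 <= 4 * M by rewrite mulr_ge0// ltW.
suff H : kappa * enorm e ^+ 2 <= L * enorm e * enorm k + 4 * M * enorm k ^+ 2.
  have eK := le_of_quadratic kappa0 (ltW L0) M4 K1 Kk e0 k0 H.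
  by rewrite (le_trans eK)// lerDl mulr_ge0// ltW.
pose a := t *: e.
have na : enorm a = t * enorm e by rewrite enormZ gtr0_norm.
have ar : enorm a <= r / 4.
  rewrite na; have := ler_wpM2l (ltW t0) es; clear -ts; lra.
have ar2 : enorm a <= r / 2 by clear -ar r0; lra.
have kar : enorm (k - a) <= r / 2.
  by rewrite (le_trans (enormB _ _))//; clear -ar kr; lra.
have akr : enorm (- (k - a)) <= r / 2 by rewrite enormN.
have nar : enorm (- a) <= r / 2 by rewrite enormN.
(* With these test points the exchanged vectors become $v + (k - a)$ and $u - (k - a)$, and all
   others move by $-a$ or $a$; every perturbation has norm at most $r/2$. *)
have := exch (z + a) (w - a).
rewrite !bary_cost_exchange /bary_cost [X in X + _ <= _](bigD1 i isT).
rewrite [X in _ + X <= _](bigD1 i isT)/= -/l -/u -/v.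
have -> : row i y - (z + a) = v + (k - a).
  by apply/rowP => j; rewrite /v /k !mxE; ring.
have -> : row i x - (w - a) = u + (- (k - a)).
  by apply/rowP => j; rewrite /u /k !mxE; ring.
rewrite [X in _ <= _ + X + _](eq_bigr (fun j =>
  lambda j * enorm ((row j x - z) + - a) `^ p)); last first.
  by move=> j _; rewrite opprD addrA.
rewrite [X in _ <= _ + (_ + X)](eq_bigr (fun j =>
  lambda j * enorm ((row j y - w) + a) `^ p)); last first.
  by move=> j _; rewrite opprB addrCA addrC.
have := ler_wpM2l (ltW li0) (quad1 v (k - a) vrs kar).
have := ler_wpM2l (ltW li0) (quad1 u (- (k - a)) urs akr).
move=> q2 q1.
have := quad (predC1 i) (fun j => row j x - z) _ xrs nar.
(* By stationarity the gradients of the points that stay sum to minus the weighted gradient at the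
   exchanged point; this doubles the gain. *)
have -> : \sum_(j | predC1 i j) lambda j *: pgrad p (row j x - z)
    = - (l *: pgrad p u).
  by apply/eqP; rewrite -addr_eq0 addrC -[X in _ == X]Sx
    [X in _ == X](bigD1 i isT).
move=> q3.
have := quad (predC1 i) (fun j => row j y - w) _ yrs ar2.
have -> : \sum_(j | predC1 i j) lambda j *: pgrad p (row j y - w)
    = - (l *: pgrad p v).
  by apply/eqP; rewrite -addr_eq0 addrC -[X in _ == X]Sy
    [X in _ == X](bigD1 i isT).
move=> q4.
move: q3 q4; rewrite /= (dotNl (l *: _) (- a)) dotNr opprK dotNl !(dotZl l) enormN.
have Dk : dot (pgrad p v) k - dot (pgrad p u) k <= L * enorm e * enorm k.
  rewrite -dotNl -dotDl (le_trans (dot_le _ _))// ler_wpM2r//.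
  exact: lip.
have Da : t * (c * enorm e ^+ 2) <= dot (pgrad p v) a - dot (pgrad p u) a.
  by rewrite -dotNl -dotDl dotZr ler_pM2l//; exact: mono.
have ka := enormB_sqr_le k a.
move: q1 q2; rewrite enormN dotNr !(dotDr k) !dotNr => q1 q2 q3 q4.
exact: (exchange_gain_le (ltW li0) li1 (ltW L0) (ltW M0) (ltW t0) e0 k0 tM na
  ka Dk Da q1 q2 q3 q4).
Qed.

(** * The countable cover and the lower bound *)

(** An integer above the sum of all $F_i + 1/F_i$ bounds every $F_i$ and every inverse at once. *)
Lemma family_in_annulus (R : realType) (I : finType) (F : I -> R) :
  (forall i, 0 < F i) ->
  exists m : nat, forall i, m.+1%:R^-1 <= F i <= m.+1%:R.
Proof.
move=> F0; pose S := \sum_i (F i + (F i)^-1).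
have FV0 i : 0 < (F i)^-1 by rewrite invr_gt0.
have T0 i : 0 <= F i + (F i)^-1 by rewrite addr_ge0// ltW.
have S0 : 0 <= S by exact: sumr_ge0.
exists (Num.bound S) => i; set b := _.+1%:R.
have Sb : S <= b by rewrite (le_trans (ltW (archi_boundP S0)))// ler_nat.
have Fb : F i + (F i)^-1 <= b.
  by rewrite (le_trans _ Sb)// /S (bigD1 i)//= lerDl sumr_ge0.
apply/andP; split; last by rewrite (le_trans _ Fb)// lerDl ltW.
by rewrite invf_ple ?posrE ?ltr0Sn// (le_trans _ Fb)// lerDr ltW.
Qed.

Unset Implicit Arguments.

Theorem proposition3p2 (R : realType) (N d : nat) (lambda : 'I_N -> R)
    (lambda_gt0 : forall i, 0 < lambda i)
    (lambda_sum : \sum_i lambda i = 1)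
    (p : R) (p_gt1 : 1 < p)
    (mu : 'I_N -> probability (borel 'rV[R]_d) R)
    (mu_moment : forall i, finite_moment p (mu i))
    (gamma : probability (borel 'M[R]_(N, d)) R)
    (gamma_coupling : couplings mu gamma)
    (gamma_monotone : cp_monotone p lambda (spt gamma)) :
  exists U : nat -> set 'M[R]_(N, d),
    D_empty p lambda `&` spt gamma `<=` \bigcup_m U m /\
    forall m, exists2 L : R, 0 < L &
      forall y y' : 'M[R]_(N, d),
        (D_empty p lambda `&` spt gamma `&` U m) y ->
        (D_empty p lambda `&` spt gamma `&` U m) y' ->
        L * enorm (y - y') <= enorm (xbar p lambda y - xbar p lambda y').
Proof.
have l0 i : 0 <= lambda i by exact: ltW.
pose U (m : nat) : set 'M[R]_(N, d) := [set y | forall i,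
  m.+1%:R^-1 <= enorm (row i y - xbar p lambda y) <= m.+1%:R].
exists U.
split=> [y [Dy _]|m].
  have [i|m my] := @family_in_annulus R _
    (fun i => enorm (row i y - xbar p lambda y)).
    (* Membership in [D_empty] says exactly that every distance to the barycenter is positive. *)
    rewrite lt_def enorm_ge0 andbT; apply/eqP => /enorm_eq0/subr0_eq yi.
    exact: (Dy i).
  by exists m.
have r0 : 0 < m.+1%:R^-1 :> R by rewrite invr_gt0.
have s0 : 0 < m.+1%:R :> R by [].
have /choice[K KP] : forall i, exists K, 0 < K /\ forall y y',
    (D_empty p lambda `&` spt gamma `&` U m) y ->
    (D_empty p lambda `&` spt gamma `&` U m) y' ->
    enorm (row i (y - y')) <= K * enorm (xbar p lambda y - xbar p lambda y').
  move=> i.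
  have [K K0 KP] := @row_displacement_le R N d lambda p _ _ i lambda_gt0
    lambda_sum p_gt1 r0 s0.
  exists K; split=> // y y' [[_ Gy] Uy] [[_ Gy'] Uy'].
  have xmin (x : 'M[R]_(N, d)) w := xbar_minimizes x w l0 (lambda_gt0 i) (ltW p_gt1).
  apply: (KP y y' (xbar p lambda y) (xbar p lambda y') Uy Uy'
    (xmin y) (xmin y')) => a b.
  (* The costs at the barycenters are at most the optimal costs, which monotonicity compares with
     those of the exchanged pair; these are at most the costs at [a] and [b]. *)
  have := cp_monotone_exchange i gamma_monotone Gy Gy'.
  have := cp_ge (xmin y); have := cp_ge (xmin y').
  have := cp_le p (exchange_row i y y') a l0.
  have := cp_le p (exchange_row i y' y) b l0.
  move=> h1 h2 h3 h4 h5.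
  exact: le_trans (lerD h4 h3) (le_trans h5 (lerD h2 h1)).
have K0 : 0 < \sum_i K i + 1.
  by rewrite ltr_wpDl// sumr_ge0// => i _; have [/ltW] := KP i.
(* The norm of $y - y'$ is at most the sum of its row norms, so the row constants add up; the
   summand 1 makes positivity immediate. *)
exists (\sum_i K i + 1)^-1 => [|y y' Uy Uy']; first by rewrite invr_gt0.
rewrite mulrC ler_pdivrMr// mulrC (le_trans (enorm_le_sum _))//.
rewrite mulrDl mul1r mulr_suml ler_wpDr ?enorm_ge0//.
by apply: ler_sum => i _; have [_] := KP i; exact.
Qed.
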